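(* Let $(X,f_{1,\infty})$ be a non-autonomous discrete dynamical system and let $\mathcal{F}=\{f_n:n\in\mathbb{N}\}$. Then (i) the NDDS $(X,f_{1,\infty})$ is extended transitive if and only if the generic dynamical system $(X,\mathcal{F})$ is topologically transitive; (ii) the NDDS $(X,f_{1,\infty})$ is strongly extended transitive if and only if the generic dynamical system $(X,\mathcal{F})$ is strongly transitive; (iii) the NDDS $(X,f_{1,\infty})$ is extended minimal if and only if the generic dynamical system $(X,\mathcal{F})$ is minimal.
   Context: $\mathbb{N}=\{1,2,3,\dots\}$. A non-autonomous discrete dynamical system (NDDS) is a pair $(X,f_{1,\infty})$ where $X$ is a compact metric space and $f_{1,\infty}=(f_n)_{n\in\mathbb{N}}$ is a sequence of continuous maps $f_n:X\to X$. $\Sigma=\{(n_1,\dots,n_p): p\in\mathbb{N},\ n_i\in\mathbb{N}\}$, and for $\alpha=(n_1,\dots,n_p)\in\Sigma$, $f_\alpha:=f_{n_p}\circ\cdots\circ f_{n_1}$. The NDDS is extended transitive if $\bigcup_{\alpha\in\Sigma}f_\alpha(V)$ is dense in $X$ for every nonempty open $V\subset X$; strongly extended transitive if $\bigcup_{\alpha\in\Sigma}f_\alpha(V)=X$ for every nonempty open $V\subset X$; extended minimal if there is no proper, nonempty, closed subset $A\subset X$ with $f_n(A)\subset A$ for all $n\in\mathbb{N}$. A generic dynamical system (GDS) is a pair $(X,\mathcal{F})$ where $X$ is a compact metric space and $\mathcal{F}$ is a collection of continuous maps $X\to X$. It is topologically transitive if for all nonempty open $U,V\subset X$ there exist $n\in\mathbb{N}$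 and $h_1,\dots,h_n\in\mathcal{F}$ such that $h_n\circ\cdots\circ h_1(U)\cap V\neq\emptyset$; strongly transitive if for every nonempty open $U\subset X$, $\bigcup_{n\in\mathbb{N},\ h_1,\dots,h_n\in\mathcal{F}} h_n\circ\cdots\circ h_1(U)=X$; minimal if there is no proper, nonempty, closed subset $A\subset X$ with $\mathcal{F}(A):=\bigcup_{h\in\mathcal{F}}h(A)\subset A$. *)

(* Defs.v *)
From mathcomp Require Import all_boot all_order all_algebra.
From mathcomp Require Import boolp classical_sets reals.
From mathcomp Require Import topology.

Set Implicit Arguments.
Unset Strict Implicit.
Unset Printing Implicit Defensive.

Local Open Scope classical_set_scope.

(* The head of the sequence is applied first:
   comp_seq [:: h1; ...; hn] = hn \o ... \o h1. *)
Definition comp_seq (T : Type) (hs : seq (T -> T)) : T -> T :=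
  foldl (fun g h => h \o g) id hs.

(* The sequence of maps is indexed by nat, starting at 0: ndds_map S n stands
   for the map f_(n+1) of a sequence f_1, f_2, ... *)
Record ndds (R : realType) (X : metricType R) := Ndds {
  ndds_compact : compact [set: X];
  ndds_map : nat -> X -> X;
  ndds_continuous : forall n, continuous (ndds_map n) }.

Record gds (R : realType) (X : metricType R) := Gds {
  gds_compact : compact [set: X];
  gds_maps : set (X -> X);
  gds_continuous : forall h, gds_maps h -> continuous h }.

Section NonAutonomous.
Context {R : realType} {X : metricType R} (S : ndds X).

Definition multi_index : set (seq nat) := [set a | a <> [::]].

Definition ndds_comp (a : seq nat) : X -> X := comp_seq (map (ndds_map S) a).

Definition extended_transitive : Prop :=
  forall V : set X, open V -> V !=set0 ->
    dense (\bigcup_(a in multi_index) (ndds_comp a @` V)).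

Definition strongly_extended_transitive : Prop :=
  forall V : set X, open V -> V !=set0 ->
    \bigcup_(a in multi_index) (ndds_comp a @` V) = [set: X].

Definition extended_minimal : Prop :=
  ~ exists A : set X, [/\ A `<` [set: X], A !=set0, closed A &
      forall n, ndds_map S n @` A `<=` A].

Lemma range_ndds_continuous (h : X -> X) : range (ndds_map S) h -> continuous h.
Proof. by move=> [n _ <-]; exact: ndds_continuous. Qed.

Definition gds_of_ndds : gds X :=
  Gds (ndds_compact S) range_ndds_continuous.

End NonAutonomous.

Section Generic.
Context {R : realType} {X : metricType R} (G : gds X).

Definition words : set (seq (X -> X)) :=
  [set hs | hs <> [::] /\
    forall i, (i < size hs)%N -> gds_maps G (nth id hs i)].

Definition topologically_transitive : Prop :=
  forall U V : set X, open U -> U !=set0 -> open V -> V !=set0 ->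
    exists2 hs, words hs & (comp_seq hs @` U) `&` V !=set0.

Definition strongly_transitive : Prop :=
  forall U : set X, open U -> U !=set0 ->
    \bigcup_(hs in words) (comp_seq hs @` U) = [set: X].

Definition minimal : Prop :=
  ~ exists A : set X, [/\ A `<` [set: X], A !=set0, closed A &
      \bigcup_(h in gds_maps G) (h @` A) `<=` A].

End Generic.

(* Main.v *)
(** A word over [F = {f_n}] is the same thing as the image of a multi-index
    under [n |-> f_n], so both systems have the same forward images [W V] of a
    set [V]; density of [W V] says that [W V] meets every nonempty open set. *)
Require Import Defs.
From mathcomp Require Import all_boot all_order all_algebra.
From mathcomp Require Import boolp classical_sets reals.
From mathcomp Require Import topology.

Local Open Scope classical_set_scope.

(** Induction on [s]: an index for the head is put before a list of indices for the tail. Membership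
    is phrased with [nth] to match [words]. *)
Lemma seq_range_map (T : Type) (f : nat -> T) (x0 : T) (s : seq T) :
  (forall i, (i < size s)%N -> range f (nth x0 s i)) ->
  exists a, map f a = s.
Proof.
elim: s => [|y s IHs] fs; first by exists [::].
have [n _ fn] := fs 0 isT; have [a fa] := IHs (fun i => fs i.+1).
by exists (n :: a); rewrite /= fn fa.
Qed.

Lemma words_gds_of_ndds (R : realType) (X : metricType R) (S : ndds X) :
  words (gds_of_ndds S) = map (ndds_map S) @` multi_index.
Proof.
apply/seteqP; split=> [hs [hs0 hsS]|_ [a a0 <-]].
  have [a fa] := seq_range_map _ _ _ _ hsS.
  by exists a => // a0; apply: hs0; rewrite -fa a0.
split=> [|i]; first by case: a a0.
by rewrite size_map => ia; rewrite (nth_map 0) //; exists (nth 0 a i).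
Qed.

(** [ndds_comp S a] unfolds to [comp_seq] of the mapped word, so reindexing the union along [map] is
    enough. *)
Lemma bigcup_words (R : realType) (X : metricType R) (S : ndds X)
    (V : set X) :
  \bigcup_(hs in words (gds_of_ndds S)) (comp_seq hs @` V) =
  \bigcup_(a in multi_index) (ndds_comp S a @` V).
Proof. by rewrite words_gds_of_ndds bigcup_image. Qed.

Theorem theorem4p8 (R : realType) (X : metricType R) (S : ndds X) :
  [/\ extended_transitive S <-> topologically_transitive (gds_of_ndds S),
      strongly_extended_transitive S <-> strongly_transitive (gds_of_ndds S) &
      extended_minimal S <-> minimal (gds_of_ndds S)].
Proof.
split.
- split=> [trS U V oU U0 oV V0|trG V oV V0 U U0 oU].
    have [y [Vy]] := trS U oU U0 V V0 oV.
    by rewrite -bigcup_words => -[hs whs hsy]; exists hs => //; exists y.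
  (* The names swap here: [V] is the source and [U] the open set on which density is tested. *)
  have [hs whs [y [hsy Uy]]] := trG V U oV V0 oU U0.
  by exists y; split=> //; rewrite -bigcup_words; exists hs.
- by split=> trS V oV V0; move: (trS V oV V0); rewrite bigcup_words.
(* A union lies in [A] iff each member does, so both minimality conditions forbid the same sets. *)
- have invE (A : set X) : (forall n, ndds_map S n @` A `<=` A) <->
      \bigcup_(h in gds_maps (gds_of_ndds S)) (h @` A) `<=` A.
    split=> [SA|GA n]; first by apply: bigcup_sub => _ [n _ <-]; exact: SA.
    by move=> y Ay; apply: GA; exists (ndds_map S n) => //; exists n.
  by split=> minS [A [AT A0 cA /invE iA]]; apply: minS; exists A.
Qed.
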